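(* Let $\Gamma_2$ be the fundamental group of a closed oriented surface of genus $2$ and let $\rho:\Gamma_2\to\mathrm{PSL}_2(\mathbb C)$ be a pentagon representation. Then $\rho$ does not lift to $\mathrm{SL}_2(\mathbb C)$, i.e. there is no homomorphism $\tilde\rho:\Gamma_2\to\mathrm{SL}_2(\mathbb C)$ whose composition with the projection $\mathrm{SL}_2(\mathbb C)\to\mathrm{PSL}_2(\mathbb C)$ is $\rho$.
   Context: Non-elementary: $\mathrm{PSL}_2(\mathbb C)$ is the group of orientation-preserving isometries of hyperbolic space $\mathbb H^3$, acting also on $\partial\mathbb H^3\simeq\mathbb{CP}^1$ by Möbius transformations. A homomorphism $\rho:G\to \mathrm{PSL}_2(\mathbb C)$ is elementary if there is $z\in\mathbb H^3\cup\partial\mathbb H^3$ whose orbit $\rho(G)\cdot z$ is finite; otherwise it is non-elementary. Pentagon representations: use the commutator convention $[\gamma,\delta]=\delta^{-1}\gamma^{-1}\delta\gamma$, and standard generators $a_1,b_1,a_2,b_2$ of $\Gamma_2$ (the usual simple loops, $a_i,b_i$ generating the $i$-th handle and each pair meeting only at the base point), subject to the single relation $[a_2,b_2][a_1,b_1]=1$. Let $\Gamma=\langle q_1,\dots,q_6\mid q_i^2=1,\ q_1q_2\cdots q_6=1\rangle$. The homomorphism $\iota:\Gamma_2\to\Gamma$, $\iota(a_1)=q_2q_1$, $\iota(b_1)=q_2q_3$, $\iota(a_2)=q_5q_4$, $\iota(b_2)=q_5q_6$, is injective and identifies $\Gamma_2$ with an index two subgroup of $\Gamma$. A pentagon representation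 is a non-elementary representation $\Gamma_2\to\mathrm{PSL}_2(\mathbb C)$ of the form $\rho'\circ\iota$, where $\rho':\Gamma\to\mathrm{PSL}_2(\mathbb C)$ is a homomorphism such that $\rho'(q_i)=\mathrm{id}$ for exactly one $i\in\{1,\dots,6\}$. *)

(* Defs.v *)
From HB Require Import structures.
From mathcomp Require Import all_boot all_order all_algebra.
From mathcomp Require Import all_classical all_reals.
From mathcomp Require Import complex ring.

Set Implicit Arguments.
Unset Strict Implicit.
Unset Printing Implicit Defensive.

Import Order.TTheory GRing.Theory Num.Theory.
Import ComplexField.Normc.

Local Open Scope group_scope.
Local Open Scope classical_set_scope.
Local Open Scope quotient_scope.

(* A letter (x, b) stands for x if b = false, for x^-1 if b = true. *)
Definition word (X : Type) := seq (X * bool).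

Section Words.
Variable X : Type.

Definition letter (x : X) : word X := [:: (x, false)].
Definition winv (w : word X) : word X := rev [seq (l.1, ~~ l.2) | l <- w].
(* The convention here is [u, v] = v^-1 u^-1 v u. *)
Definition wcomm (u v : word X) : word X := winv v ++ winv u ++ v ++ u.

Definition word_eval (G : groupType) (f : X -> G) (w : word X) : G :=
  \prod_(l <- w) (if l.2 then (f l.1)^-1 else f l.1).

End Words.

(* The group < X | rels >. *)
Section Presentation.
Variables (X : choiceType) (rels : seq (word X)).

Inductive word_equiv : word X -> word X -> Prop :=
| WRefl u : word_equiv u u
| WSym u v : word_equiv u v -> word_equiv v u
| WTrans u v w : word_equiv u v -> word_equiv v w -> word_equiv u w
| WCat u u' v v' :
    word_equiv u u' -> word_equiv v v' -> word_equiv (u ++ v) (u' ++ v')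
| WCancel x b : word_equiv [:: (x, b); (x, ~~ b)] [::]
| WRel r : r \in rels -> word_equiv r [::].

Definition word_equivb (u v : word X) : bool := `[< word_equiv u v >].

Lemma word_equivb_refl : reflexive word_equivb.
Proof. by move=> u; apply/asboolP; exact: WRefl. Qed.

Lemma word_equivb_sym : symmetric word_equivb.
Proof. by move=> u v; apply/asboolP/asboolP; exact: WSym. Qed.

Lemma word_equivb_trans : transitive word_equivb.
Proof.
move=> v u w /asboolP uv /asboolP vw; apply/asboolP; exact: WTrans uv vw.
Qed.

Canonical word_equiv_rel :=
  EquivRel word_equivb word_equivb_refl word_equivb_sym word_equivb_trans.

Definition presented := {eq_quot word_equiv_rel}.

HB.instance Definition _ := Choice.on presented.
HB.instance Definition _ := EqQuotient.on presented.

Definition cls (w : word X) : presented := \pi_presented w.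
Definition gen (x : X) : presented := cls (letter x).

Lemma clsP u v : cls u = cls v <-> word_equiv u v.
Proof.
split; first by move/eqP; rewrite /cls eqmodE => /asboolP.
by move=> uv; apply/eqP; rewrite /cls eqmodE; apply/asboolP.
Qed.

Lemma cls_repr (g : presented) : cls (repr g) = g.
Proof. exact: reprK. Qed.

Lemma repr_cls u : word_equiv (repr (cls u)) u.
Proof. by apply/clsP; rewrite cls_repr. Qed.

Definition pmul (g h : presented) : presented := cls (repr g ++ repr h).
Definition pinv (g : presented) : presented := cls (winv (repr g)).

Lemma winv_cat u v : winv (u ++ v) = winv v ++ winv u :> word X.
Proof. by rewrite /winv map_cat rev_cat. Qed.

Lemma winvK : involutive (@winv X).
Proof.
move=> u; rewrite /winv map_rev revK -map_comp map_id_in //.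
by move=> [x b] _ /=; rewrite negbK.
Qed.

Lemma winvl u : word_equiv (winv u ++ u) [::].
Proof.
elim: u => [|[x b] u IH]; first exact: WRefl.
rewrite -cat1s winv_cat -catA; apply: (WTrans _ IH).
apply: WCat (WRefl _) _; rewrite catA -[X in word_equiv _ X]cat0s.
apply: WCat (WRefl _); rewrite /winv /=.
by rewrite -[X in (x, X) :: nil]negbK; exact: WCancel.
Qed.

Lemma winvr u : word_equiv (u ++ winv u) [::].
Proof. by rewrite -{1}[u]winvK; exact: winvl. Qed.

Lemma word_equiv_winv u v : word_equiv u v -> word_equiv (winv u) (winv v).
Proof.
move=> uv; apply: (@WTrans _ (winv u ++ (v ++ winv v))).
  rewrite -[X in word_equiv X _]cats0.
  exact: WCat (WRefl _) (WSym (winvr _)).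
rewrite catA -[X in word_equiv _ X]cat0s; apply: WCat (WRefl _).
apply: WTrans (winvl u); exact: WCat (WRefl _) (WSym uv).
Qed.

Lemma cls_cat u v : cls (u ++ v) = pmul (cls u) (cls v).
Proof. by apply/clsP; apply: WSym; apply: WCat; exact: repr_cls. Qed.

Lemma cls_winv u : cls (winv u) = pinv (cls u).
Proof. by apply/clsP/WSym/word_equiv_winv/repr_cls. Qed.

Lemma cls_surj (P : presented -> Prop) : (forall u, P (cls u)) -> forall g, P g.
Proof. by move=> Pu g; rewrite -[g]cls_repr. Qed.

Fact pmulA : associative pmul.
Proof.
elim/cls_surj=> u; elim/cls_surj=> v; elim/cls_surj=> w.
by rewrite -!cls_cat catA.
Qed.

Fact pmul1 : left_id (cls [::]) pmul.
Proof. by elim/cls_surj=> u; rewrite -cls_cat. Qed.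

Fact pmulr1 : right_id (cls [::]) pmul.
Proof. by elim/cls_surj=> u; rewrite -cls_cat cats0. Qed.

Fact pmulV : left_inverse (cls [::]) pinv pmul.
Proof.
by elim/cls_surj=> u; rewrite -cls_winv -cls_cat; apply/clsP/winvl.
Qed.

Fact pmulrV : right_inverse (cls [::]) pinv pmul.
Proof.
by elim/cls_surj=> u; rewrite -cls_winv -cls_cat; apply/clsP/winvr.
Qed.

HB.instance Definition _ :=
  isGroup.Build presented pmulA pmul1 pmulr1 pmulV pmulrV.

Lemma clsM u v : cls (u ++ v) = cls u * cls v.
Proof. exact: cls_cat. Qed.

Lemma clsV u : cls (winv u) = (cls u)^-1.
Proof. exact: cls_winv. Qed.

Lemma cls_rel r : r \in rels -> cls r = 1.
Proof. by move=> rP; apply/clsP; exact: WRel. Qed.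

(* Universal property: a map f from the generators to G killing the relators  *)
(* extends to a homomorphism from < X | rels > to G.                          *)
Section Lift.
Variables (G : groupType) (f : X -> G).
Hypothesis f_rels : forall r, r \in rels -> word_eval f r = 1.

Lemma word_evalP u v : word_equiv u v -> word_eval f u = word_eval f v.
Proof.
elim=> //.
- by move=> {}u {}v w _ -> _ ->.
- move=> {}u u' {}v v' _ IHu _ IHv; rewrite /word_eval !big_cat /=.
  by rewrite -!/(word_eval _ _) IHu IHv.
- move=> x b; rewrite /word_eval !big_cons !big_nil mulg1.
  by case: b => /=; rewrite ?mulgV ?mulVg.
- by move=> r /f_rels ->; rewrite /word_eval big_nil.
Qed.

Definition presented_lift of (forall r, r \in rels -> word_eval f r = 1) :=
  fun g : presented => word_eval f (repr g).

Local Notation lift := (presented_lift f_rels).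

Lemma presented_lift_cls u : lift (cls u) = word_eval f u.
Proof. exact/word_evalP/repr_cls. Qed.

Lemma presented_lift_gen x : lift (gen x) = f x.
Proof.
by rewrite presented_lift_cls /word_eval /letter big_cons big_nil mulg1.
Qed.

Fact presented_liftM : {morph lift : g h / g * h}.
Proof.
elim/cls_surj=> u; elim/cls_surj=> v.
by rewrite -clsM !presented_lift_cls /word_eval big_cat.
Qed.

Fact presented_lift1 : lift 1 = 1.
Proof. by rewrite presented_lift_cls /word_eval big_nil. Qed.

HB.instance Definition _ :=
  isUMagmaMorphism.Build presented G lift (presented_lift1, presented_liftM).

End Lift.
End Presentation.

(* Gamma = < q_1, ..., q_6 | q_i^2 = 1, q_1 q_2 ... q_6 = 1 >; the generator  *)
(* q_k is indexed by the ordinal k - 1.                                       *)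
Definition Gamma_rels : seq (word 'I_6) :=
  [seq letter i ++ letter i | i <- enum 'I_6]
    ++ [:: flatten [seq letter i | i <- enum 'I_6]].

Definition Gamma := presented Gamma_rels.
HB.instance Definition _ := Group.on Gamma.

Definition q (i : 'I_6) : Gamma := gen Gamma_rels i.

Definition q1 : Gamma := q (Ordinal (isT : 0 < 6)%N).
Definition q2 : Gamma := q (Ordinal (isT : 1 < 6)%N).
Definition q3 : Gamma := q (Ordinal (isT : 2 < 6)%N).
Definition q4 : Gamma := q (Ordinal (isT : 3 < 6)%N).
Definition q5 : Gamma := q (Ordinal (isT : 4 < 6)%N).
Definition q6 : Gamma := q (Ordinal (isT : 5 < 6)%N).

(* Gamma_2 = < a_1, b_1, a_2, b_2 | [a_2, b_2] [a_1, b_1] = 1 >, the          *)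
(* fundamental group of the closed oriented surface of genus 2; the ordinals  *)
(* 0, 1, 2, 3 index a_1, b_1, a_2, b_2.                                       *)
Definition ia1 : 'I_4 := Ordinal (isT : 0 < 4)%N.
Definition ib1 : 'I_4 := Ordinal (isT : 1 < 4)%N.
Definition ia2 : 'I_4 := Ordinal (isT : 2 < 4)%N.
Definition ib2 : 'I_4 := Ordinal (isT : 3 < 4)%N.

Definition Gamma2_rels : seq (word 'I_4) :=
  [:: wcomm (letter ia2) (letter ib2) ++ wcomm (letter ia1) (letter ib1)].

Definition Gamma2 := presented Gamma2_rels.
HB.instance Definition _ := Group.on Gamma2.

Definition a1 : Gamma2 := gen Gamma2_rels ia1.
Definition b1 : Gamma2 := gen Gamma2_rels ib1.
Definition a2 : Gamma2 := gen Gamma2_rels ia2.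
Definition b2 : Gamma2 := gen Gamma2_rels ib2.

Lemma Gamma2_rel :
  (b2^-1 * a2^-1 * b2 * a2) * (b1^-1 * a1^-1 * b1 * a1) = 1.
Proof.
rewrite -(@cls_rel _ Gamma2_rels _ (mem_head _ _)) /wcomm !clsM !clsV.
by rewrite !mulgA.
Qed.

Lemma q_invol i : q i * q i = 1.
Proof.
rewrite -(@cls_rel _ Gamma_rels (letter i ++ letter i)) ?clsM //.
rewrite mem_cat; apply/orP; left; apply/mapP; exists i => //.
by rewrite mem_enum.
Qed.

Lemma q_prod : q1 * q2 * q3 * q4 * q5 * q6 = 1.
Proof.
pose r : word 'I_6 := flatten [seq letter i | i <- enum 'I_6].
have rE : r = letter (Ordinal (isT : 0 < 6)%N) ++
    letter (Ordinal (isT : 1 < 6)%N) ++ letter (Ordinal (isT : 2 < 6)%N) ++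
    letter (Ordinal (isT : 3 < 6)%N) ++ letter (Ordinal (isT : 4 < 6)%N) ++
    letter (Ordinal (isT : 5 < 6)%N).
  rewrite /r !enum_ordSl enum_ord0 /=.
  by do !congr (_ :: _); congr (_, _); apply: val_inj.
rewrite -(@cls_rel _ Gamma_rels r); last by rewrite mem_cat mem_head orbT.
by rewrite rE !clsM !mulgA.
Qed.

Definition iota_gen (i : 'I_4) : Gamma :=
  nth 1 [:: q2 * q1; q2 * q3; q5 * q4; q5 * q6] i.

Fact iota_rels r : r \in Gamma2_rels -> word_eval iota_gen r = 1.
Proof.
rewrite inE => /eqP ->; rewrite /word_eval /= !big_cons big_nil /= !mulg1.
have qV i : (q i)^-1 = q i by apply: (mulgI (q i)); rewrite mulgV q_invol.
have qK i x : q i * (q i * x) = x by rewrite mulgA q_invol mul1g.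
rewrite /iota_gen /= !invgM /q1 /q2 /q3 /q4 /q5 /q6 !qV -!mulgA !qK.
have := q_prod; rewrite /q1 /q2 /q3 /q4 /q5 /q6 => qP.
set x1 := q _ in qP *; set x2 := q _ in qP *; set x3 := q _ in qP *.
set x4 := q _ in qP *; set x5 := q _ in qP *; set x6 := q _ in qP *.
have E : x6 * (x5 * x4) = x1 * (x2 * x3).
  apply: (mulIg (x4 * (x5 * x6))); rewrite -!mulgA !qK q_invol.
  by rewrite -qP -!mulgA.
have -> : forall y, x6 * (x5 * (x4 * y)) = x1 * (x2 * (x3 * y)).
  by move=> y; rewrite !mulgA -[_ * x4]mulgA E !mulgA.
have -> : forall y, x6 * (x5 * (x4 * y)) = x1 * (x2 * (x3 * y)).
  by move=> y; rewrite !mulgA -[_ * x4]mulgA E !mulgA.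
by rewrite !qK q_invol.
Qed.

Definition iota_Gamma : Gamma2 -> Gamma := presented_lift iota_rels.
HB.instance Definition _ := Multiplicative.on iota_Gamma.

Lemma iota_Gamma_a1 : iota_Gamma a1 = q2 * q1. Proof. exact: presented_lift_gen. Qed.
Lemma iota_Gamma_b1 : iota_Gamma b1 = q2 * q3. Proof. exact: presented_lift_gen. Qed.
Lemma iota_Gamma_a2 : iota_Gamma a2 = q5 * q4. Proof. exact: presented_lift_gen. Qed.
Lemma iota_Gamma_b2 : iota_Gamma b2 = q5 * q6. Proof. exact: presented_lift_gen. Qed.

Local Open Scope ring_scope.

Section SL2.
Variable F : fieldType.

Definition SL2 : Type := {A : 'M[F]_2 | \det A == 1}.
HB.instance Definition _ := Choice.on SL2.
HB.instance Definition _ := SubType.on SL2.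

Implicit Types A B : SL2.

Lemma SL2_det A : \det (val A) = 1.
Proof. exact/eqP/(valP A). Qed.

Fact SL2_one_subproof : \det (1%:M : 'M[F]_2) == 1.
Proof. by rewrite det1. Qed.
Definition SL2_one : SL2 := Sub 1%:M SL2_one_subproof.

Fact SL2_mul_subproof A B : \det (val A *m val B) == 1.
Proof. by rewrite det_mulmx !SL2_det mulr1. Qed.
Definition SL2_mul A B : SL2 := Sub (val A *m val B) (SL2_mul_subproof A B).

Fact SL2_inv_subproof A : \det (invmx (val A)) == 1.
Proof. by rewrite det_inv SL2_det invr1. Qed.
Definition SL2_inv A : SL2 := Sub (invmx (val A)) (SL2_inv_subproof A).

Fact SL2_opp_subproof A : \det (- val A) == 1.
Proof. by rewrite -scaleN1r detZ SL2_det sqrrN expr1n mulr1. Qed.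
Definition SL2_opp A : SL2 := Sub (- val A) (SL2_opp_subproof A).

Lemma SL2_unitmx A : val A \in unitmx.
Proof. by rewrite unitmxE SL2_det unitr1. Qed.

Fact SL2_mulA : associative SL2_mul.
Proof. by move=> A B D; apply: val_inj; rewrite /= mulmxA. Qed.
Fact SL2_mul1 : left_id SL2_one SL2_mul.
Proof. by move=> A; apply: val_inj; rewrite /= mul1mx. Qed.
Fact SL2_mulr1 : right_id SL2_one SL2_mul.
Proof. by move=> A; apply: val_inj; rewrite /= mulmx1. Qed.
Fact SL2_mulV : left_inverse SL2_one SL2_inv SL2_mul.
Proof. by move=> A; apply: val_inj; rewrite /= mulVmx ?SL2_unitmx. Qed.
Fact SL2_mulrV : right_inverse SL2_one SL2_inv SL2_mul.
Proof. by move=> A; apply: val_inj; rewrite /= mulmxV ?SL2_unitmx. Qed.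

HB.instance Definition _ :=
  isGroup.Build SL2 SL2_mulA SL2_mul1 SL2_mulr1 SL2_mulV SL2_mulrV.

Lemma SL2_oppK : involutive SL2_opp.
Proof. by move=> A; apply: val_inj; rewrite /= opprK. Qed.
Lemma SL2_mulN A B : (SL2_opp A * B)%g = SL2_opp (A * B)%g.
Proof. by apply: val_inj; rewrite /= mulNmx. Qed.
Lemma SL2_mulrN A B : (A * SL2_opp B)%g = SL2_opp (A * B)%g.
Proof. by apply: val_inj; rewrite /= mulmxN. Qed.
Lemma SL2_invN A : ((SL2_opp A)^-1)%g = SL2_opp (A^-1)%g.
Proof.
by apply: (mulgI (SL2_opp A)); rewrite mulgV SL2_mulN SL2_mulrN SL2_oppK mulgV.
Qed.

Definition pm_equiv A B : bool := (A == B) || (A == SL2_opp B).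

Lemma pm_equivP A B : reflect (A = B \/ A = SL2_opp B) (pm_equiv A B).
Proof.
apply: (iffP orP) => [[] /eqP|[] ->]; by [left | right | left | right].
Qed.

Lemma pm_equiv_refl : reflexive pm_equiv.
Proof. by move=> A; rewrite /pm_equiv eqxx. Qed.
Lemma pm_equiv_sym : symmetric pm_equiv.
Proof.
move=> A B; rewrite /pm_equiv eq_sym; congr (_ || _).
by rewrite -(inj_eq (can_inj SL2_oppK)) SL2_oppK eq_sym.
Qed.
Lemma pm_equiv_trans : transitive pm_equiv.
Proof.
move=> B A D /pm_equivP AB /pm_equivP BD; apply/pm_equivP.
by case: AB BD => -> [] ->; rewrite ?SL2_oppK; [left|right|right|left].
Qed.

Canonical pm_equiv_rel :=
  EquivRel pm_equiv pm_equiv_refl pm_equiv_sym pm_equiv_trans.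

Definition PSL2 := {eq_quot pm_equiv_rel}.
HB.instance Definition _ := Choice.on PSL2.
HB.instance Definition _ := EqQuotient.on PSL2.

Definition proj (A : SL2) : PSL2 := \pi_PSL2 A.

Lemma projP A B : proj A = proj B <-> A = B \/ A = SL2_opp B.
Proof.
split; first by move/eqP; rewrite /proj eqmodE => /pm_equivP.
by move=> AB; apply/eqP; rewrite /proj eqmodE; apply/pm_equivP.
Qed.

Lemma proj_repr (g : PSL2) : proj (repr g) = g.
Proof. exact: reprK. Qed.

Lemma repr_proj A : repr (proj A) = A \/ repr (proj A) = SL2_opp A.
Proof. by apply/projP; rewrite proj_repr. Qed.

Lemma proj_surj (P : PSL2 -> Prop) : (forall A, P (proj A)) -> forall g, P g.
Proof. by move=> PA g; rewrite -[g]proj_repr. Qed.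

Definition PSL2_mul (g h : PSL2) : PSL2 := proj (repr g * repr h)%g.
Definition PSL2_inv (g : PSL2) : PSL2 := proj (repr g)^-1%g.

Lemma proj_mul A B : proj (A * B)%g = PSL2_mul (proj A) (proj B).
Proof.
apply/projP; case: (repr_proj A) => ->; case: (repr_proj B) => ->;
  rewrite ?SL2_mulN ?SL2_mulrN ?SL2_oppK; by [left | right].
Qed.

Lemma proj_inv A : proj (A^-1)%g = PSL2_inv (proj A).
Proof.
apply/projP; case: (repr_proj A) => ->; rewrite ?SL2_invN ?SL2_oppK;
  by [left | right].
Qed.

Fact PSL2_mulA : associative PSL2_mul.
Proof.
elim/proj_surj=> A; elim/proj_surj=> B; elim/proj_surj=> D.
by rewrite -!proj_mul mulgA.
Qed.
Fact PSL2_mul1 : left_id (proj 1%g) PSL2_mul.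
Proof. by elim/proj_surj=> A; rewrite -proj_mul mul1g. Qed.
Fact PSL2_mulr1 : right_id (proj 1%g) PSL2_mul.
Proof. by elim/proj_surj=> A; rewrite -proj_mul mulg1. Qed.
Fact PSL2_mulV : left_inverse (proj 1%g) PSL2_inv PSL2_mul.
Proof. by elim/proj_surj=> A; rewrite -proj_inv -proj_mul mulVg. Qed.
Fact PSL2_mulrV : right_inverse (proj 1%g) PSL2_inv PSL2_mul.
Proof. by elim/proj_surj=> A; rewrite -proj_inv -proj_mul mulgV. Qed.

HB.instance Definition _ :=
  isGroup.Build PSL2 PSL2_mulA PSL2_mul1 PSL2_mulr1 PSL2_mulV PSL2_mulrV.

HB.instance Definition _ :=
  isUMagmaMorphism.Build SL2 PSL2 proj (erefl, proj_mul).

End SL2.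

Section Action.
Variable R : realType.
Local Open Scope complex_scope.
Local Notation C := R[i].

(* Hyperbolic 3-space, in the upper half-space model C x R_{>0}.              *)
Definition H3 : Type := {p : C * R | 0 < p.2}.

(* The boundary CP^1 = C u {oo}, with oo = None. *)
Definition CP1 : Type := option C.

Section Formulas.
Variable A : 'M[C]_2.
Local Notation a := (A 0 0).
Local Notation b := (A 0 1).
Local Notation c := (A 1 0).
Local Notation d := (A 1 1).

Definition moebius (z : CP1) : CP1 :=
  match z with
  | Some z => if c * z + d == 0 then None else Some ((a * z + b) / (c * z + d))
  | None => if c == 0 then None else Some (a / c)
  end.

(* The Poincare extension of the Moebius transformation of A to C x R_{>0},   *)
(* for det A = 1:                                                             *)
(*   (z, t) |-> (((a z + b) (c z + d)^* + a c^* t^2) / D, t / D)              *)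
(* where D = |c z + d|^2 + |c|^2 t^2.                                         *)
Definition poincare_den (p : C * R) : R :=
  normc (c * p.1 + d) ^+ 2 + normc c ^+ 2 * p.2 ^+ 2.

Definition poincare (p : C * R) : C * R :=
  (((a * p.1 + b) * conjc (c * p.1 + d) + a * conjc c * (p.2 ^+ 2)%:C)
     / (poincare_den p)%:C,
   p.2 / poincare_den p).

End Formulas.

Lemma det2 (A : 'M[C]_2) : \det A = A 0 0 * A 1 1 - A 0 1 * A 1 0.
Proof.
rewrite (expand_det_row _ 0) big_ord_recl big_ord1 /cofactor !det_mx11 !mxE /=.
rewrite addn0 expr0 mul1r expr1 mulN1r mulrN.
by congr (A _ _ * A _ _ - A _ _ * A _ _); apply: val_inj.
Qed.

Lemma normc_sqr (z : C) : (normc z ^+ 2)%:C = z * conjc z.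
Proof. by rewrite -sqr_normc rmorphXn. Qed.

Lemma normc_ge0 (z : C) : 0 <= normc z.
Proof. by case: z => x y; rewrite /normc sqrtr_ge0. Qed.

Lemma normc_opp (z : C) : normc (- z) = normc z.
Proof. by case: z => x y; rewrite /normc /= !sqrrN. Qed.

Lemma normc_gt0 (z : C) : z != 0 -> 0 < normc z.
Proof.
move=> z0; rewrite lt_def normc_ge0 andbT.
by apply: contraNneq z0 => /eq0_normc ->.
Qed.

Lemma poincare_den_gt0 (A : 'M[C]_2) (p : C * R) :
  \det A = 1 -> 0 < p.2 -> 0 < poincare_den A p.
Proof.
rewrite det2 => detA p_gt0; rewrite /poincare_den.
have sq_ge0 (x : R) : 0 <= x ^+ 2 by exact: sqr_ge0.
have [c0|c0] := eqVneq (A 1 0) 0; last first.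
  apply: ltr_wpDl => //; apply: mulr_gt0; apply: exprn_gt0 => //.
  exact: normc_gt0.
apply: ltr_pwDl; last exact: mulr_ge0.
apply: exprn_gt0; apply: normc_gt0; rewrite c0 mul0r add0r.
apply/eqP => d0; move/eqP: detA.
by rewrite c0 d0 !mulr0 subr0 eq_sym oner_eq0.
Qed.

Fact act_H3_subproof (A : SL2 C) (p : H3) : 0 < (poincare (val A) (val p)).2.
Proof.
by rewrite divr_gt0 ?poincare_den_gt0 ?SL2_det //; exact: valP p.
Qed.

Definition SL2_act_H3 (A : SL2 C) (p : H3) : H3 :=
  Sub (poincare (val A) (val p)) (act_H3_subproof A p).

Definition closed_H3 : Type := H3 + CP1.

Definition SL2_act (A : SL2 C) (x : closed_H3) : closed_H3 :=
  match x with
  | inl p => inl (SL2_act_H3 A p)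
  | inr z => inr (moebius (val A) z)
  end.

(* Independent of the representative of g by PSL2_act_proj below. *)
Definition PSL2_act (g : PSL2 C) (x : closed_H3) : closed_H3 :=
  SL2_act (repr g) x.

Lemma SL2_act_opp A x : SL2_act (SL2_opp A) x = SL2_act A x.
Proof.
case: x => [p|[z|]] /=.
- congr inl; apply: val_inj => /=; rewrite /poincare /poincare_den !mxE.
  by rewrite !mulNr -!opprD !normc_opp !rmorphN /= !(mulrNN, mulNr, mulrN, opprK).
- rewrite !mxE !mulNr -!opprD oppr_eq0; case: ifP => // _.
  by rewrite invrN mulrNN.
- by rewrite !mxE oppr_eq0 invrN mulrNN.
Qed.

Lemma PSL2_act_proj A x : PSL2_act (proj A) x = SL2_act A x.
Proof. by rewrite /PSL2_act; case: (repr_proj A) => ->; rewrite ?SL2_act_opp. Qed.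

Lemma SL2_act1 x : SL2_act 1%g x = x.
Proof.
pose I : 'M[C]_2 := 1%:M.
have I00 : I 0 0 = 1 by rewrite mxE.
have I01 : I 0 1 = 0 by rewrite mxE.
have I10 : I 1 0 = 0 by rewrite mxE.
have I11 : I 1 1 = 1 by rewrite mxE.
case: x => [p|[z|]]; rewrite /SL2_act.
- congr inl; apply: val_inj; rewrite [LHS]/(poincare I (val p)).
  have den1 : poincare_den I (val p) = 1.
    rewrite /poincare_den I10 I11 mul0r add0r normc0 normc1.
    by rewrite expr1n expr0n mul0r addr0.
  rewrite /poincare den1 I00 I01 I10 I11 mul1r mul0r add0r addr0.
  rewrite rmorph1 rmorph0 mulr0 mul0r addr0 mulr1 !divr1.
  by case: (val p).
- rewrite -/I /= I00 I01 I10 I11 mul0r mul1r add0r addr0 oner_eq0.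
  by rewrite divr1.
- by rewrite -/I /= I10 eqxx.
Qed.

Lemma mul2E (A B : 'M[C]_2) i j : (A *m B) i j = A i 0 * B 0 j + A i 1 * B 1 j.
Proof.
rewrite mxE big_ord_recl big_ord1; congr (_ + A _ _ * B _ _); exact: val_inj.
Qed.

Lemma moebiusM (A B : 'M[C]_2) z : \det A = 1 -> \det B = 1 ->
  moebius (A *m B) z = moebius A (moebius B z).
Proof.
rewrite !det2 => detA detB.
have key x y : (x != 0) || (y != 0) ->
   (if A 1 0 * x + A 1 1 * y == 0 then None
    else Some ((A 0 0 * x + A 0 1 * y) / (A 1 0 * x + A 1 1 * y))) =
   moebius A (if y == 0 then None else Some (x / y)).
  have [->|y0] := eqVneq y 0 => [/=|_ /=].
    rewrite orbF !mulr0 !addr0 => x0; rewrite mulf_eq0 (negPf x0) orbF.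
    by case: eqVneq => // c0; congr Some; field; rewrite c0.
  have -> : A 1 0 * (x / y) + A 1 1 = (A 1 0 * x + A 1 1 * y) / y by field.
  rewrite mulf_eq0 invr_eq0 (negPf y0) orbF.
  by case: eqVneq => // D0; congr Some; field; rewrite ?y0 ?D0.
case: z => [z|] /=; rewrite !mul2E.
  have -> : (A 1 0 * B 0 0 + A 1 1 * B 1 0) * z + (A 1 0 * B 0 1 + A 1 1 * B 1 1)
    = A 1 0 * (B 0 0 * z + B 0 1) + A 1 1 * (B 1 0 * z + B 1 1) by ring.
  have -> : (A 0 0 * B 0 0 + A 0 1 * B 1 0) * z + (A 0 0 * B 0 1 + A 0 1 * B 1 1)
    = A 0 0 * (B 0 0 * z + B 0 1) + A 0 1 * (B 1 0 * z + B 1 1) by ring.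
  apply: key; rewrite -negb_and; apply/negP => /andP[/eqP e0 /eqP e1].
  have /eqP : 1 = B 0 0 * (B 1 0 * z + B 1 1) - B 1 0 * (B 0 0 * z + B 0 1).
    by rewrite -detB; ring.
  by rewrite e0 e1 !mulr0 subr0 oner_eq0.
apply: key; rewrite -negb_and; apply/negP => /andP[/eqP e0 /eqP e1].
have /eqP := detB; by rewrite e0 e1 mulr0 mul0r subr0 eq_sym oner_eq0.
Qed.

Lemma poincare_denE (A : 'M[C]_2) (p : C * R) : (poincare_den A p)%:C =
  (A 1 0 * p.1 + A 1 1) * conjc (A 1 0 * p.1 + A 1 1)
  + A 1 0 * conjc (A 1 0) * p.2%:C ^+ 2.
Proof.
have rcD (x y : R) : (x + y)%:C = x%:C + y%:C by exact: rmorphD.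
have rcM (x y : R) : (x * y)%:C = x%:C * y%:C by exact: rmorphM.
by rewrite /poincare_den rcD normc_sqr rcM normc_sqr [X in X%:C]expr2 rcM.
Qed.

Lemma poincareM (A B : 'M[C]_2) (p : C * R) : \det A = 1 -> \det B = 1 -> 0 < p.2 ->
  poincare (A *m B) p = poincare A (poincare B p).
Proof.
move=> detA detB t_gt0; pose D := poincare_den B p.
have D_gt0 : 0 < D by exact: poincare_den_gt0.
have D0 : D%:C != 0 by rewrite fmorph_eq0 gt_eqF.
have q_gt0 : 0 < (poincare B p).2 by rewrite divr_gt0.
have den_gt0 := poincare_den_gt0 detA q_gt0.
move: detB; rewrite det2 => dB.
have dB' : conjc (B 0 0) * conjc (B 1 1) - conjc (B 0 1) * conjc (B 1 0) = 1.
  by rewrite -!rmorphM -rmorphB dB [LHS]rmorph1.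
have DE := poincare_denE B p; rewrite -/D in DE.
have cD (x y : C) : conjc (x + y) = conjc x + conjc y by exact: rmorphD.
have cM (x y : C) : conjc (x * y) = conjc x * conjc y by exact: rmorphM.
have cX : conjc p.2%:C = p.2%:C by exact: conjc_real.
pose N := (B 0 0 * p.1 + B 0 1) * conjc (B 1 0 * p.1 + B 1 1)
  + B 0 0 * conjc (B 1 0) * p.2%:C ^+ 2.
pose E := (B 0 0 * p.1 + B 0 1) * conjc (B 0 0 * p.1 + B 0 1)
  + B 0 0 * conjc (B 0 0) * p.2%:C ^+ 2.
have BpE : poincare B p = (N / D%:C, p.2 / D).
  by rewrite /poincare -/D rmorphXn.
have NE : conjc N = conjc (B 0 0 * p.1 + B 0 1) * (B 1 0 * p.1 + B 1 1)
    + conjc (B 0 0) * B 1 0 * p.2%:C ^+ 2.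
  by rewrite /N cD !cM !conjcK !cX.
have ED : N * conjc N + p.2%:C ^+ 2 = E * D%:C.
  rewrite NE /N /E DE !(cD, cM) -[X in _ + X = _]mulr1.
  rewrite -[X in _ + _ * X = _]mulr1.
  by rewrite -{1}dB -dB'; ring.
have qE1 : conjc (N / D%:C) = conjc N / D%:C.
  by rewrite cM conjc_inv (conjc_real D).
have quad a1 b1 a2 b2 : (a1 * (N / D%:C) + b1) * (a2 * (conjc N / D%:C) + b2)
   + a1 * a2 * (p.2%:C / D%:C) ^+ 2 =
   (a1 * a2 * E + a1 * b2 * N + b1 * a2 * conjc N + b1 * b2 * D%:C) / D%:C.
  have -> : E = (N * conjc N + p.2%:C ^+ 2) / D%:C by rewrite ED mulfK.
  by field.
have qC : (p.2 / D)%:C = p.2%:C / D%:C by exact: fmorph_div.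
have rcM (x y : R) : (x * y)%:C = x%:C * y%:C by exact: rmorphM.
have denMC : (poincare_den (A *m B) p)%:C =
    (poincare_den A (poincare B p))%:C * D%:C.
  rewrite !poincare_denE BpE qC.
  rewrite [in RHS]cD [in RHS]cM qE1 quad -DE divfK // !mul2E.
  by rewrite /E NE /N DE !(cD, cM); ring.
have denM : poincare_den (A *m B) p = poincare_den A (poincare B p) * D.
  by apply: complexI; rewrite rcM.
rewrite /poincare denM -/(poincare B p) BpE; congr pair; last first.
  by rewrite /= invfM mulrA mulrAC.
have rcX (x : R) : (x ^+ 2)%:C = x%:C ^+ 2 by exact: rmorphXn.
rewrite rcM invfM mulrA mulrAC -BpE; congr (_ / _).
rewrite !rcX BpE [fst _]/= [snd _]/= qC.
have -> : conjc (A 1 0 * (N / D%:C) + A 1 1) =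
    conjc (A 1 0) * (conjc N / D%:C) + conjc (A 1 1) by rewrite cD cM qE1.
rewrite quad; congr (_ / _).
rewrite !mul2E /E NE /N DE !(cD, cM); ring.
Qed.

Lemma SL2_actM A B x : SL2_act (A * B)%g x = SL2_act A (SL2_act B x).
Proof.
case: x => [p|z]; rewrite /SL2_act; last first.
  by congr inr; apply: moebiusM; exact: SL2_det.
congr inl; apply: val_inj; apply: poincareM; rewrite ?SL2_det //.
exact: valP p.
Qed.

Lemma PSL2_act1 x : PSL2_act 1%g x = x.
Proof. by rewrite PSL2_act_proj SL2_act1. Qed.

Lemma PSL2_actM g h x : PSL2_act (g * h)%g x = PSL2_act g (PSL2_act h x).
Proof.
elim/proj_surj: g => A; elim/proj_surj: h => B.
by rewrite -gmulfM !PSL2_act_proj SL2_actM.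
Qed.

Section Representations.
Variable G : groupType.

Definition elementary (rho : {multiplicative G -> PSL2 C}) : Prop :=
  exists x : closed_H3, finite_set [set PSL2_act (rho g) x | g in [set: G]].

Definition lifts_to_SL2 (rho : {multiplicative G -> PSL2 C}) : Prop :=
  exists rhot : {multiplicative G -> SL2 C}, forall g, proj (rhot g) = rho g.

End Representations.

Definition pentagon (rho : {multiplicative Gamma2 -> PSL2 C}) : Prop :=
  ~ elementary rho /\
  exists rho' : {multiplicative Gamma -> PSL2 C},
    (exists! i : 'I_6, rho' (q i) = 1%g) /\
    (forall g, rho g = rho' (iota_Gamma g)).

End Action.

(* Main.v *)
Require Import Defs.
From mathcomp Require Import all_boot all_order all_algebra.
From mathcomp Require Import all_classical all_reals.
From mathcomp Require Import complex.
From mathcomp Require Import ring.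

(** Lift each involution [rho' (q i)] to a matrix [x i] in SL_2.  A non-trivial
    involution of PSL_2 lifts to a square root of [-1], so five of the squares
    [x i * x i] are [-1] and the sixth is [1].  Commutators in SL_2 depend only
    on the classes in PSL_2, so a lift of [rho] sends [[a2,b2][a1,b1]] to the
    corresponding word in the [x i].  As the product of the [x i] is central of
    square [1], this word equals the product of the squares, that is
    [(-1)^5 = -1], contradicting the relation of the surface group. *)

(* [Defs] again, because [all_classical] shadows its [proj]. *)
Import GRing.Theory Num.Theory Defs.

Local Open Scope group_scope.

(** The inner square [c * c] is central and moves out, which brings the two [b] together. *)
Lemma mul_rev3_central (G : groupType) (a b c : G) :
    (forall g, commute (b * b) g) -> (forall g, commute (c * c) g) ->
  (a * b * c) * (c * b * a) = (a * a) * (b * b) * (c * c).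
Proof.
move=> bC cC; transitivity (a * (b * (c * c)) * b * a); first by rewrite !mulgA.
rewrite -(cC b) -!mulgA (mulgA b b a) (bC a) (mulgA c c) (cC (a * _)).
by rewrite !mulgA.
Qed.

(* With u = x0 x1 x2, v = x3 x4 x5 and u', v' their reversals, the commutators
   are v^-1 v' and u^-1 u', while u u' and v v' are products of squares. *)
Lemma commg_prod_central_squares (G : groupType) (x : nat -> G)
    (P := x 0%N * x 1%N * x 2%N * x 3%N * x 4%N * x 5%N) :
    (forall i g, commute (x i * x i) g) -> (forall g, commute P g) ->
  [~ x 4%N * x 5%N, x 4%N * x 3%N] * [~ x 1%N * x 2%N, x 1%N * x 0%N] * (P * P) =
  \prod_(i < 6) (x i * x i).
Proof.
move=> sqC PC.
pose u := x 0%N * x 1%N * x 2%N; pose u' := x 2%N * x 1%N * x 0%N.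
pose v := x 3%N * x 4%N * x 5%N; pose v' := x 5%N * x 4%N * x 3%N.
have PE : P = u * v by rewrite /P /u /v !mulgA.
have commE (a b c : G) : [~ a * b, a * c] = (c * a * b)^-1 * (b * a * c).
  by rewrite commgEl conjgE !invgM -!mulgA mulKg.
have uu' : u * u' = x 0%N * x 0%N * (x 1%N * x 1%N) * (x 2%N * x 2%N).
  exact: mul_rev3_central.
pose s := x 3%N * x 3%N * (x 4%N * x 4%N) * (x 5%N * x 5%N).
have vv' : v * v' = s by exact: mul_rev3_central.
have sC g : commute s g.
  by apply/commute_sym/commuteM; [apply: commuteM|]; apply/commute_sym/sqC.
have -> : \prod_(i < 6) (x i * x i) = u * u' * s.
  by rewrite !big_ord_recl big_ord0 mulg1 uu' /s !mulgA.
rewrite !commE -/u -/u' -/v -/v'.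
clearbody P u u' v v' s.
have -> : v' = v^-1 * s by rewrite -vv' mulKg.
(* As [P] is central, one copy goes in front of each [v^-1]; then [P * v^-1] is [u]. *)
transitivity ((P * v^-1) * (P * v^-1) * s * u^-1 * u').
  have PPC g : commute (P * P) g by apply/commute_sym/commuteM; exact/commute_sym.
  by rewrite -PPC !mulgA -(mulgA P v^-1) -(PC v^-1) !mulgA.
by rewrite PE mulgK -(mulgA u) -(sC u) !mulgA mulgK -(mulgA u) sC mulgA.
Qed.

(* [{multiplicative G -> H}] only asserts compatibility with products. *)
Section Multiplicative.
Variables (G H : groupType) (f : {multiplicative G -> H}).

Lemma multiplicative1 : f 1 = 1.
Proof. by apply: (mulgI (f 1)); rewrite -gmulfM !mulg1. Qed.

Lemma multiplicativeV g : f g^-1 = (f g)^-1.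
Proof. by apply: (mulgI (f g)); rewrite -gmulfM !mulgV multiplicative1. Qed.

Lemma multiplicativeR g h : f [~ g, h] = [~ f g, f h].
Proof. by rewrite !commgEl !conjgE !gmulfM !multiplicativeV. Qed.

End Multiplicative.

Section SL2Signs.
Variable F : fieldType.
Implicit Types A B D E : SL2 F.

(** Each entry occurs in its commutator once directly and once inverted, so signs cancel. *)
Lemma commg_proj A B D E :
  proj A = proj B -> proj D = proj E -> [~ A, D] = [~ B, E].
Proof.
by move=> /projP[]-> /projP[]->;
  rewrite !commgEl !conjgE ?SL2_invN ?(SL2_mulN, SL2_mulrN, SL2_oppK).
Qed.

Lemma SL2_oppC A : commute (SL2_opp 1) A.
Proof. by rewrite /commute SL2_mulN SL2_mulrN mul1g mulg1. Qed.

Lemma SL2_opp_sq : SL2_opp 1 * SL2_opp 1 = 1 :> SL2 F.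
Proof. by rewrite SL2_mulN SL2_mulrN SL2_oppK mulg1. Qed.

Lemma proj_eq1 A : proj A = 1 -> A = 1 \/ A = SL2_opp 1.
Proof. by move/(projP A 1). Qed.

End SL2Signs.

Section Pentagon.
Variable R : realType.
Local Notation C := R[i].
Local Open Scope ring_scope.

Lemma SL2_opp1_neq1 : SL2_opp 1%g <> 1%g :> SL2 C.
Proof.
move=> /(congr1 (fun A : SL2 C => (val A) 0 0)); rewrite /= !mxE /= => /eqP.
by rewrite eq_sym -subr_eq0 opprK -mulr2n pnatr_eq0.
Qed.

(** By Cayley-Hamilton, the trace times [M] is twice the identity; hence the trace is nonzero and
    [M] is scalar. *)
Lemma mx2_sq1 (M : 'M[C]_2) :
  \det M = 1 -> M *m M = 1%:M -> M = 1%:M \/ M = - 1%:M.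
Proof.
rewrite det2 => detM M2.
have MME i j : (M *m M) i j = (i == j)%:R by rewrite M2 mxE.
have e00 : _ = 1 := MME 0 0; have e01 : _ = 0 := MME 0 1.
have e10 : _ = 0 := MME 1 0; have e11 : _ = 1 := MME 1 1.
rewrite !mul2E in e00 e01 e10 e11.
have aT : M 0 0 * (M 0 0 + M 1 1) = 2.
  by rewrite (_ : 2 = 1 + 1) // -{1}e00 -detM; ring.
have T0 : M 0 0 + M 1 1 != 0.
  by apply: contra_eq_neq aT => ->; rewrite mulr0 eq_sym pnatr_eq0.
have b0 : M 0 1 = 0 by apply: (mulIf T0); rewrite mul0r -[RHS]e01; ring.
have c0 : M 1 0 = 0 by apply: (mulIf T0); rewrite mul0r -[RHS]e10; ring.
rewrite b0 mul0r ?addr0 ?subr0 in e00 detM.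
have da : M 1 1 = M 0 0 by rewrite -[LHS]mul1r -e00 -mulrA detM mulr1.
have ME : M = (M 0 0)%:M.
  apply/matrixP=> i j; rewrite mxE.
  have ord2 (k : 'I_2) : k = 0 \/ k = 1.
    by case: k => [[|[|//]] ltk]; [left|right]; apply: val_inj.
  by case: (ord2 i) (ord2 j) => -> [] ->; rewrite ?b0 ?c0 ?da ?mulr1n ?mulr0n.
have /eqP := e00; rewrite -expr2 sqrf_eq1 => /orP[]/eqP a1; [left|right].
  by rewrite ME a1.
by rewrite ME a1 raddfN.
Qed.

Lemma SL2_sq1 (A : SL2 C) : (A * A)%g = 1%g -> A = 1%g \/ A = SL2_opp 1%g.
Proof.
move/(congr1 val)/(mx2_sq1 _ (SL2_det A)) => A1.
by case: A1 => A1; [left|right]; apply: val_inj.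
Qed.

(** The square of the lift is 1 or -1; if it were 1, [SL2_sq1] would make [g] trivial. *)
Lemma PSL2_invol_sq (g : PSL2 C) : (g * g = 1)%g -> g <> 1%g ->
  (repr g * repr g)%g = SL2_opp 1%g.
Proof.
rewrite -{1 2 3}[g]proj_repr -gmulfM => g2 g1.
case: (proj_eq1 _ _ g2) => // /SL2_sq1 A1; case: g1.
exact/(projP (repr g) 1%g).
Qed.

End Pentagon.

Theorem proposition3p1 (R : realType)
    (rho : {multiplicative Gamma2 -> PSL2 R[i]}) :
  pentagon rho -> ~ lifts_to_SL2 rho.
Proof.
case=> _ [rho' [[i0 [rho'i0 i0_uniq]] rhoE]] [rhot rhotE].
pose x k := repr (rho' (q (inord k))) : SL2 R[i].
have projx k : proj (x k) = rho' (q (inord k)) by exact: proj_repr.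
have q_inord (i : 'I_6) k : nat_of_ord i = k -> q (inord k) = q i.
  by move=> <-; rewrite inord_val.
have sqx (i : 'I_6) : x i * x i = if i == i0 then 1 else SL2_opp 1.
  rewrite /x inord_val; case: eqVneq => [->|ii0].
    have : proj (repr (rho' (q i0))) = 1 by rewrite proj_repr.
    by case/proj_eq1=> ->; rewrite ?mulg1 ?SL2_opp_sq.
  apply: PSL2_invol_sq; first by rewrite -gmulfM q_invol multiplicative1.
  by move=> /i0_uniq i0i; rewrite i0i eqxx in ii0.
have sqC k g : commute (x k * x k) g.
  (* For [k] beyond 5, [inord k] defaults to 0, so every [x k] is one of the six lifts. *)
  have -> : x k = x (inord k : 'I_6) by rewrite /x inord_val.
  rewrite sqx; case: eqP => _; last exact: SL2_oppC.
  exact/commute_sym/commute1.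
pose P := x 0%N * x 1%N * x 2%N * x 3%N * x 4%N * x 5%N.
have projP1 : proj P = 1.
  rewrite /P !gmulfM /= !projx -!gmulfM.
  rewrite -(multiplicative1 _ _ rho') -q_prod /q1 /q2 /q3 /q4 /q5 /q6.
  by congr (rho' (_ * _ * _ * _ * _ * _)); apply: q_inord.
have PC g : commute P g.
  case: (proj_eq1 _ _ projP1) => ->; last exact: SL2_oppC.
  exact/commute_sym/commute1.
have PP : P * P = 1.
  by case: (proj_eq1 _ _ projP1) => ->; rewrite ?mulg1 ?SL2_opp_sq.
have prod_sq : \prod_(i < 6) (x i * x i) = SL2_opp 1.
  rewrite (eq_bigr _ (fun i _ => sqx i)) !big_ord_recl big_ord0 -!val_eqE.
  (* Wherever [i0] lies, five factors -1 remain, an odd number. *)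
  by case: {+}i0 => [[|[|[|[|[|[|//]]]]]] ?] /=;
    rewrite !(mul1g, mulg1, SL2_opp_sq).
have rhot_gen (g : Gamma2) (i j : 'I_6) k l : iota_Gamma g = q i * q j ->
    nat_of_ord i = k -> nat_of_ord j = l -> proj (rhot g) = proj (x k * x l).
  by move=> gE <- <-; rewrite rhotE rhoE gE !gmulfM /= !projx !inord_val.
apply: (@SL2_opp1_neq1 R); rewrite -prod_sq -(commg_prod_central_squares _ x) //.
rewrite -/P PP mulg1 -(multiplicative1 _ _ rhot) -Gamma2_rel.
(* [[~ g, h]] is [g^-1 * h^-1 * g * h], the opposite order to [wcomm]: the relation becomes
   [[~ b2, a2] * [~ b1, a1] = 1]. *)
have -> : forall g h k l : Gamma2,
    g^-1 * h^-1 * g * h * (k^-1 * l^-1 * k * l) = [~ g, h] * [~ k, l].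
  by move=> *; rewrite !commgEl !conjgE !mulgA.
rewrite gmulfM !multiplicativeR; congr (_ * _); apply: commg_proj; symmetry.
- exact: rhot_gen iota_Gamma_b2 _ _.
- exact: rhot_gen iota_Gamma_a2 _ _.
- exact: rhot_gen iota_Gamma_b1 _ _.
- exact: rhot_gen iota_Gamma_a1 _ _.
Qed.
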